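(* Let $X$ and $Y$ be topological spaces. (1) If $X$ and $Y$ are both Markov $k$-Rothberger, then so is $X\times Y$. In other words, the property of being Markov $k$-Rothberger is finitely productive. (2) If $X$ and $Y$ are both Markov $k$-Menger, then so is $X\times Y$. In other words, the property of being Markov $k$-Menger is finitely productive.
   Context: No separation axioms are assumed on topological spaces. A $k$-cover of a space $Z$ is an open cover $\mathscr U$ of $Z$ such that every compact subset of $Z$ is contained in a member of $\mathscr U$; $\mathcal K_Z$ denotes the set of all $k$-covers of $Z$ (a $k$-cover is allowed to contain $Z$ itself). $[S]^{<\omega}$ denotes the set of finite subsets of $S$. In the $k$-Rothberger (resp. $k$-Menger) game on $Z$, in round $n\in\omega$ P1 plays $\mathscr U_n\in\mathcal K_Z$ and P2 responds with $U_n\in\mathscr U_n$ (resp. with $\mathscr F_n\in[\mathscr U_n]^{<\omega}$). P2 wins if $\{U_n:n\in\omega\}\in\mathcal K_Z$ (resp. $\bigcup\{\mathscr F_n:n\in\omega\}\in\mathcal K_Z$); otherwise P1 wins. A Markov strategy for P2 uses only the most recent move of P1 and the round number: it is a function $\sigma$ on $\mathcal K_Z\times\omega$ with $\sigma(\mathscr U,n)\in\mathscr U$ (resp. $\sigma(\mathscr U,n)\in[\mathscr U]^{<\omega}$); it is winning if for every sequence $\langle\mathscr U_n:n\in\omega\rangle$ in $\mathcal K_Z$ one has $\{\sigma(\mathscr U_n,n):n\in\omega\}\in\mathcal K_Z$ (resp. $\bigcup\{\sigma(\mathscr U_n,n):n\in\omega\}\in\mathcal K_Z$). $Z$ is Markov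 $k$-Rothberger (resp. Markov $k$-Menger) if P2 has a winning Markov strategy in the $k$-Rothberger (resp. $k$-Menger) game on $Z$. *)

(* Defs.v *)
From mathcomp Require Import all_boot.
From mathcomp Require Import all_classical topology.

Set Implicit Arguments.
Unset Strict Implicit.
Unset Printing Implicit Defensive.

Local Open Scope classical_set_scope.

Definition open_cover (Z : topologicalType) (U : set (set Z)) : Prop :=
  U `<=` open /\ \bigcup_(A in U) A = [set: Z].

(* [setT] itself may be a member of a k-cover. *)
Definition k_cover (Z : topologicalType) (U : set (set Z)) : Prop :=
  open_cover U /\
  forall K : set Z, compact K -> exists2 A : set Z, U A & K `<=` A.

(* P2's winning conditions, in terms of the sequence of P2's moves. *)
Definition k_Rothberger_win (Z : topologicalType) (A : nat -> set Z) : Prop :=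
  k_cover (range A).

Definition k_Menger_win (Z : topologicalType) (F : nat -> set (set Z)) : Prop :=
  k_cover (\bigcup_n F n).

(* A Markov strategy is a function on (k-covers) x nat; here it is a total
   function on families of sets, and its values on families that are not
   k-covers are never constrained nor used. *)
Definition k_Rothberger_Markov_strategy (Z : topologicalType)
    (sigma : set (set Z) -> nat -> set Z) : Prop :=
  forall (U : set (set Z)) (n : nat), k_cover U -> U (sigma U n).

Definition k_Menger_Markov_strategy (Z : topologicalType)
    (sigma : set (set Z) -> nat -> set (set Z)) : Prop :=
  forall (U : set (set Z)) (n : nat), k_cover U ->
    finite_set (sigma U n) /\ sigma U n `<=` U.

Definition Markov_k_Rothberger (Z : topologicalType) : Prop :=
  exists2 sigma : set (set Z) -> nat -> set Z,
    k_Rothberger_Markov_strategy sigma &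
    forall U : nat -> set (set Z), (forall n, k_cover (U n)) ->
      k_Rothberger_win (fun n => sigma (U n) n).

Definition Markov_k_Menger (Z : topologicalType) : Prop :=
  exists2 sigma : set (set Z) -> nat -> set (set Z),
    k_Menger_Markov_strategy sigma &
    forall U : nat -> set (set Z), (forall n, k_cover (U n)) ->
      k_Menger_win (fun n => sigma (U n) n).

(* Main.v *)
Require Import Defs.
From mathcomp Require Import all_boot.
From mathcomp Require Import all_classical topology.

Set Implicit Arguments.
Unset Strict Implicit.
Unset Printing Implicit Defensive.

Local Open Scope classical_set_scope.

(** A Markov strategy is winning exactly when every compact set is caught, in
    some fixed round [n], by the answers to all k-covers: otherwise P1 picks
    in each round a k-cover whose answer misses that compact set.  So the
    Markov properties say that the compact sets are exhausted by countably many
    "small" sets (resp. small families of sets), where smallness is a condition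
    on one k-cover at a time.  Smallness is preserved by products because of the
    tube lemma: for a k-cover [W] of [X * Y] and a compact [K] in [X], the open
    sets [V] such that [U `*` V] lies in a member of [W] for some neighbourhood
    [U] of [K] form a k-cover of [Y]. *)

(** The filter [F] is arbitrary so that it can be the neighbourhood filter of a point as well as
    that of a compact set. *)
Lemma compact_near_set_nbhs {X : topologicalType} {I : Type}
    (F : set_system I) (A : set X) (P : X -> I -> Prop) : Filter F -> compact A ->
  (forall x, A x -> \forall x' \near x & i \near F, P x' i) ->
  filter_prod (set_nbhs A) F [set p | P p.1 p.2].
Proof.
move=> FF /compact_near_coveringP cA AP.
(* [F] is improper, for instance, when it consists of the neighbourhoods of the empty set. *)
have [F0|F0] := pselect (F set0).
  exists (setT, set0) => /=; last by move=> [x i] [_ []].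
  by split=> //; exact: (@filterT _ (set_nbhs A)).
have PF : ProperFilter F by split.
(* Covering [A] along the small members [M] of [F], rather than along [F],
   yields one [M] that works on a whole neighbourhood of each point of [A]. *)
have [M [FM AM]] : exists M, F M /\
    A `<=` [set x | nbhs x [set x' | M `<=` P x']].
  apply: (@filter_ex _ (powerset_filter_from F)); apply: filterI.
    exact: near_small_set.
  have := cA _ (powerset_filter_from F)
    (fun M x => nbhs x [set x' | M `<=` P x']).
  apply=> x Ax.
  have [[U V] /= [xU FV] UVP] := AP x Ax.
  (* The interior, because [U] has to be a neighbourhood of every nearby [x']. *)
  exists (U°, [set M | M `<=` V]) => /=.
    by split; [exact: nbhs_interior|exact: small_set_sub].
  move=> [x' M] /= [Ux' MV]; apply: filterS Ux' => z Uz i /MV Vi.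
  exact: (UVP (z, i)).
by exists ([set x | M `<=` P x], M) => // -[x i] [/= MP /MP].
Qed.

Section TubeLemma.
Context {X Y : topologicalType}.

(** Compactness is used twice: along [L] at each fixed point [x] of [K], then along [K] with the
    neighbourhoods of [L] as the filter. *)
Lemma near_set_nbhsX (K : set X) (L : set Y) (O : set (X * Y)) :
  compact K -> compact L -> open O -> K `*` L `<=` O ->
  filter_prod (set_nbhs K) (set_nbhs L) O.
Proof.
move=> cK cL oO KLO.
suff : filter_prod (set_nbhs K) (set_nbhs L) [set p | O (p.1, p.2)].
  by apply: filterS => -[].
apply: (compact_near_set_nbhs (P := fun x y => O (x, y))) => // x Kx.
have : filter_prod (set_nbhs L) (nbhs x) [set p | O (p.2, p.1)].
  apply: (compact_near_set_nbhs (P := fun y x => O (x, y))) => // y Ly.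
  have [[U V] /= [xU yV] UVO] : nbhs (x, y) O.
    by apply: open_nbhs_nbhs; split => //; exact: KLO.
  by exists (V, U) => // -[y' x'] [/= Vy' Ux']; exact: UVO.
by case=> -[V U] [/= LV xU] VUO; exists (U, V) => // -[x' y] [/= Ux' Vy];
  exact: (VUO (y, x')).
Qed.

Lemma tube_open (K : set X) (L : set Y) (O : set (X * Y)) :
  compact K -> compact L -> open O -> K `*` L `<=` O ->
  exists V, [/\ open V, L `<=` V &
    set_nbhs K [set x | forall y, V y -> O (x, y)]].
Proof.
move=> cK cL oO /(near_set_nbhsX cK cL oO) [[U V] /= [KU LV] UVO].
have [V' [oV' LV' V'V]] := (set_nbhsP L V).1 LV.
exists V'; split=> //; apply: filterS KU => x Ux y /V'V Vy; exact: (UVO (x, y)).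
Qed.

Lemma compact_fst (K : set (X * Y)) : compact K -> compact (fst @` K).
Proof.
by apply: continuous_compact; apply: continuous_subspaceT => p; exact: cvg_fst.
Qed.

Lemma compact_snd (K : set (X * Y)) : compact K -> compact (snd @` K).
Proof.
by apply: continuous_compact; apply: continuous_subspaceT => p; exact: cvg_snd.
Qed.

End TubeLemma.

(** Covering is automatic since singletons are compact. *)
Lemma k_coverP (Z : topologicalType) (U : set (set Z)) :
  k_cover U <-> U `<=` open /\
    forall K, compact K -> exists2 A, U A & K `<=` A.
Proof.
split=> [[[]] //|[Uo Uk]]; split=> //; split=> //; apply/seteqP; split=> // z _.
by have [A UA zA] := Uk [set z] (@compact_set1 _ z); exists A => //; exact: zA.
Qed.

Definition k_bounded (Z : topologicalType) (C : set Z) : Prop :=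
  forall U, k_cover U -> exists2 A, U A & C `<=` A.

Lemma Markov_k_RothbergerP (Z : topologicalType) :
  Markov_k_Rothberger Z <-> exists2 C : nat -> set Z,
    (forall n, k_bounded (C n)) & forall K, compact K -> exists n, K `<=` C n.
Proof.
split=> [[s sU swin]|[C Cb CK]].
  (* The largest set that lies in every answer of round [n]. *)
  exists (fun n => \bigcap_(U in @k_cover Z) s U n) => [n U Uk|K cK].
    by exists (s U n); [exact: sU|exact: bigcap_inf].
  apply: contrapT => /forallNP nK.
  have /choice [U UP] n : exists U, k_cover U /\ ~ K `<=` s U n.
    apply: contrapT => nU; apply: (nK n) => x Kx U Uk.
    by apply: contrapT => nsx; apply: nU; exists U; split=> // /(_ x Kx).
  have [_ /(_ K cK) [_ [n _ <-]]] := swin U (fun n => (UP n).1).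
  exact: (UP n).2.
(* Conversely, P2 answers in round [n] with a member that contains [C n]. *)
have /choice [s sP] (p : set (set Z) * nat) :
    exists A, k_cover p.1 -> p.1 A /\ C p.2 `<=` A.
  case: p => U n /=; have [Uk|nUk] := pselect (k_cover U); last first.
    by exists set0.
  by have [A UA CA] := Cb n U Uk; exists A.
exists (fun U n => s (U, n)) => [U n Uk|U Uk]; first exact: (sP (U, n) Uk).1.
apply/k_coverP; split=> [_ [n _ <-]|K /CK [n KC]].
  by have [[Uo _] _] := Uk n; apply: Uo; exact: (sP (U n, n) (Uk n)).1.
exists (s (U n, n)); first by exists n.
by apply: subset_trans KC _; exact: (sP (U n, n) (Uk n)).2.
Qed.

(** A family of sets replaces the single set of [k_bounded], since sets caught in the same round may
    lie in different members of the finite answer. *)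
Definition k_small (Z : topologicalType) (C : set (set Z)) : Prop :=
  forall U, k_cover U -> exists F, [/\ finite_set F, F `<=` U &
    forall K, C K -> exists2 A, F A & K `<=` A].

Lemma Markov_k_MengerP (Z : topologicalType) :
  Markov_k_Menger Z <-> exists2 C : nat -> set (set Z),
    (forall n, k_small (C n)) & forall K, compact K -> exists n, C n K.
Proof.
split=> [[s sU swin]|[C Cs CK]].
  exists (fun n => [set K | forall U, k_cover U ->
      exists2 A, s U n A & K `<=` A]) => [n U Uk|K cK].
    have [sf sub] := sU U n Uk.
    by exists (s U n); split=> // K; exact.
  apply: contrapT => /forallNP nK.
  have /choice [U UP] n :
      exists U, k_cover U /\ ~ exists2 A, s U n A & K `<=` A.
    apply: contrapT => nU; apply: (nK n) => U Uk.
    by apply: contrapT => nsK; apply: nU; exists U.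
  have [_ /(_ K cK) [A [n _ sA] KA]] := swin U (fun n => (UP n).1).
  by apply: (UP n).2; exists A.
have /choice [s sP] (p : set (set Z) * nat) : exists F, k_cover p.1 ->
    [/\ finite_set F, F `<=` p.1 &
      forall K, C p.2 K -> exists2 A, F A & K `<=` A].
  case: p => U n /=; have [Uk|nUk] := pselect (k_cover U); last first.
    by exists set0.
  by have [F FP] := Cs n U Uk; exists F.
exists (fun U n => s (U, n)) => [U n Uk|U Uk]; first by case: (sP (U, n) Uk).
apply/k_coverP; split=> [A [n _ sA]|K /CK [n CnK]].
  by have [_ /(_ A sA) UA _] := sP (U n, n) (Uk n); exact: (Uk n).1.1.
have [_ _ /(_ K CnK) [A sA KA]] := sP (U n, n) (Uk n).
by exists A => //; exists n.
Qed.

Section Product.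
Context {X Y : topologicalType}.

Lemma tube_k_cover (W : set (set (X * Y))) (K : set X) :
  k_cover W -> compact K ->
  k_cover [set V : set Y | open V /\ exists2 A, W A &
    set_nbhs K [set x | forall y, V y -> A (x, y)]].
Proof.
move=> [[Wo _] Wk] cK; apply/k_coverP; split=> [V []//|L cL].
have [A WA KLA] := Wk _ (compact_setX cK cL).
have [V [oV LV KVA]] := tube_open cK cL (Wo _ WA) KLA.
by exists V => //; split=> //; exists A.
Qed.

(** For each compact [K], one tube member absorbs [D]; the resulting neighbourhoods of [K] form a
    k-cover of [X], one member of which absorbs [C]. *)
Lemma k_boundedX (C : set X) (D : set Y) :
  k_bounded C -> k_bounded D -> k_bounded (C `*` D).
Proof.
move=> Cb Db W Wk.
have /Cb [U [_ [A WA UDA]] CU] : k_cover [set U : set X | open U /\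
    exists2 A, W A & U `*` D `<=` A].
  apply/k_coverP; split=> [U []//|K cK].
  have [V [oV [A WA KVA]] DV] := Db _ (tube_k_cover Wk cK).
  have [U [oU KU UVA]] := (set_nbhsP K _).1 KVA.
  exists U => //; split=> //; exists A => // -[x y] [/= Ux /DV Vy].
  exact: UVA.
by exists A => // -[x y] [/= /CU Ux Dy]; exact: UDA.
Qed.

Lemma k_smallX (C : set (set X)) (D : set (set Y)) :
  k_small C -> k_small D ->
  k_small [set K : set (X * Y) | C (fst @` K) /\ D (snd @` K)].
Proof.
move=> Cs Ds W Wk.
pose good (U : set X) (F : set (set (X * Y))) :=
  [/\ finite_set F, F `<=` W &
    forall L, D L -> exists2 A, F A & U `*` L `<=` A].
have /Cs [G [Gfin Ggood CG]] : k_cover [set U | open U /\ exists F, good U F].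
  apply/k_coverP; split=> [U []//|K cK].
  have [H [Hfin Hsub DH]] := Ds _ (tube_k_cover Wk cK).
  have /choice [w wP] V : exists A, H V -> W A /\
      set_nbhs K [set x | forall y, V y -> A (x, y)].
    have [HV|nHV] := pselect (H V); last by exists set0.
    by have [_ [A WA KVA]] := Hsub V HV; exists A.
  (* Finiteness of [H] allows one neighbourhood of [K] to serve all its members. *)
  have : set_nbhs K [set x | forall V, H V -> forall y, V y -> w V (x, y)].
    have /finite_fsetP [h Hh] := Hfin; rewrite Hh.
    apply: filter_bigI => V hV; apply: (wP V _).2.
    by rewrite Hh.
  move=> /set_nbhsP [U [oU KU UHw]].
  exists U => //; split=> //; exists (w @` H); split.
  - exact: finite_image.
  - by move=> _ [V HV <-]; exact: (wP V HV).1.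
  - move=> L /DH [V HV LV]; exists (w V); first by exists V.
    by move=> -[x y] [/= Ux /LV Vy]; exact: (UHw x Ux V HV).
have /choice [f fP] U : exists F, G U -> good U F.
  have [GU|nGU] := pselect (G U); last by exists set0.
  by have [_ [F FP]] := Ggood U GU; exists F.
exists (\bigcup_(U in G) f U); split.
- by apply: bigcup_finite => // U /fP [].
- by move=> A [U /fP [_ + _]]; exact.
- move=> K [/= /CG [U GU KU] DK]; have [_ _ /(_ _ DK) [A fA UA]] := fP U GU.
  exists A; first by exists U.
  (* [K] lies in the product of its projections. *)
  by move=> p Kp; apply: UA; split; [apply: KU; exists p|exists p].
Qed.

Lemma Markov_k_RothbergerX : Markov_k_Rothberger X -> Markov_k_Rothberger Y ->
  Markov_k_Rothberger (X * Y)%type.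
Proof.
move=> /Markov_k_RothbergerP [C Cb CK] /Markov_k_RothbergerP [D Db DK].
apply/Markov_k_RothbergerP.
(* Rounds enumerate the pairs of indices; the default pair is harmless, as every pair gives a
   [k_bounded] product. *)
pose idx k : nat * nat := odflt (0, 0) (unpickle k).
exists (fun k => C (idx k).1 `*` D (idx k).2) => [k|K cK].
  exact: k_boundedX.
have [n KC] := CK _ (compact_fst cK); have [m KD] := DK _ (compact_snd cK).
exists (pickle (n, m)); rewrite /idx pickleK /= => p Kp.
by split; [apply: KC|apply: KD]; exists p.
Qed.

Lemma Markov_k_MengerX : Markov_k_Menger X -> Markov_k_Menger Y ->
  Markov_k_Menger (X * Y)%type.
Proof.
move=> /Markov_k_MengerP [C Cs CK] /Markov_k_MengerP [D Ds DK].
apply/Markov_k_MengerP.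
pose idx k : nat * nat := odflt (0, 0) (unpickle k).
exists (fun k => [set K : set (X * Y) |
    C (idx k).1 (fst @` K) /\ D (idx k).2 (snd @` K)]) => [k|K cK].
  exact: k_smallX.
have [n KC] := CK _ (compact_fst cK); have [m KD] := DK _ (compact_snd cK).
by exists (pickle (n, m)); rewrite /idx pickleK.
Qed.

End Product.

Theorem theorem4p32 (X Y : topologicalType) :
  (Markov_k_Rothberger X -> Markov_k_Rothberger Y ->
   Markov_k_Rothberger (X * Y)%type) /\
  (Markov_k_Menger X -> Markov_k_Menger Y ->
   Markov_k_Menger (X * Y)%type).
Proof. by split; [exact: Markov_k_RothbergerX|exact: Markov_k_MengerX]. Qed.
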